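(* Let $\mathcal{X}$ be a finite-dimensional real Hilbert space, $n\ge 1$, $L>0$, $\tau\in[0,L]$, and let $f_1,\dots,f_n:\mathcal{X}\to\mathbb{R}$ be $L$-smooth and $\tau$-weakly convex functions. Let $f=\frac1n\sum_{i=1}^n f_i$, suppose that $f^\star=\inf f>-\infty$, that $f$ is $\mu$-PŁ for some $\mu>0$, and let $\kappa=L/\mu$. Let $(x^t,g^t)_{t\ge0}$ be generated by the algorithm PAGE with probability $p\in(0,1]$, initial points $x^0,g^0\in\mathcal{X}$, and stepsize $$\gamma=\frac{\eta}{L\left(1+\sqrt{\frac{4\tau}{L+\tau}}\sqrt{\frac{1-p}{p}}\right)}$$ for some constant $\eta\in(0,1)$. Set $a=1-\frac{\gamma(L-\tau)}{2}$, $b=\frac{\gamma(L-\tau)}{2}$ and $$\Psi^t=f(x^t)-f^\star-b\gamma\|\nabla f(x^t)\|^2+\frac{a\gamma}{p}\|g^t-\nabla f(x^t)\|^2+\frac{b\gamma}{p}\|g^t\|^2 .$$ Then the number of iterations $t$ needed to reach $\mathbb{E}[\Psi^t]\le\epsilon$ is $$\mathcal{O}\left(\left(\kappa+\kappa\sqrt{\frac{\tau}{Lp}}+\frac1p\right)\log\left(\frac{\Psi^0}{\epsilon}\right)\right).$$ Since each iteration requires $np+2(1-p)$ gradient evaluations on average, the complexity in terms of (expected) number of gradient evaluations is $$\mathcal{O}\left(\left(\kappa+\kappa pn+\kappa\sqrt{\frac{\tau}{Lp}}+\kappa\sqrt{\frac{\tau}{L}}\,n\sqrt p+\frac1p+n\right)\log\left(\frac{\Psi^0}{\epsilon}\right)\right).$$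 With the choice $p=c/n$ for a constant $c>0$ (with $c\le n$), the latter is $$\mathcal{O}\left(\left(\kappa+\kappa\sqrt{\frac{\tau n}{L}}+n\right)\log\left(\frac{\Psi^0}{\epsilon}\right)\right).$$
   Context: A function $h:\mathcal{X}\to\mathbb{R}$ is $L$-smooth if it is differentiable on $\mathcal{X}$ and $\|\nabla h(x)-\nabla h(y)\|\le L\|x-y\|$ for all $x,y\in\mathcal{X}$. It is $\tau$-weakly convex if $h+\frac{\tau}{2}\|\cdot\|^2$ is convex. The function $f$ with $f^\star=\inf f>-\infty$ is $\mu$-PŁ (Polyak–Łojasiewicz) if $\|\nabla f(x)\|^2\ge2\mu(f(x)-f^\star)$ for every $x\in\mathcal{X}$. Algorithm PAGE. Inputs: (deterministic) $x^0,g^0\in\mathcal{X}$, stepsize $\gamma>0$, probability $p\in(0,1]$. For $t=0,1,2,\dots$: set $x^{t+1}=x^t-\gamma g^t$. Draw $\theta^t\in\{0,1\}$ with $\mathbb{P}(\theta^t=1)=p$, and $i^t$ uniformly at random in $\{1,\dots,n\}$. If $\theta^t=0$, set $g^{t+1}=g^t+\nabla f_{i^t}(x^{t+1})-\nabla f_{i^t}(x^t)$ (counted as 2 gradient evaluations); if $\theta^t=1$, set $g^{t+1}=\nabla f(x^{t+1})$ (counted as $n$ gradient evaluations). All the random variables $\theta^0,i^0,\theta^1,i^1,\dots$ are mutually independent. The gradient-evaluation complexity is the number of iterations times the expected number $np+2(1-p)$ of gradient evaluations per iteration. Meaning of $\mathcal{O}$: the bounds hold for all accuracies $0<\epsilon\le\Psi^0/2$,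 with hidden constants depending only on $\eta$ (and on $c$ for the last bound), not on $\mathcal{X},n,L,\tau,\mu,p,\epsilon$, the functions or the initial points. ''The number of iterations needed is $\mathcal{O}(B)$'' means: there is a hidden constant $C$ and an integer $t_0\le CB$ such that $\mathbb{E}[\Psi^t]\le\epsilon$ for all $t\ge t_0$. *)

(* Defs.v *)
From HB Require Import structures.
From mathcomp Require Import all_boot all_order all_algebra.
From mathcomp Require Import finmap.
From mathcomp Require Import all_classical all_reals all_analysis.

Set Implicit Arguments.
Unset Strict Implicit.
Unset Printing Implicit Defensive.

Import Order.TTheory GRing.Theory Num.Theory.
Import numFieldNormedType.Exports.

Local Open Scope classical_set_scope.
Local Open Scope ring_scope.

Definition finite_dimensional (R : realType) (X : lmodType R) : Prop :=
  exists (d : nat) (e : 'I_d -> X),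
    forall v : X, exists c : 'I_d -> R, v = \sum_(i < d) c i *: e i.

(* [X] is a finite-dimensional Hilbert space for the inner product [dot]:
   completeness is automatic in finite dimension. *)
Definition finite_dim_hilbert (R : realType) (X : normedModType R)
    (dot : {dot X for @idfun R}) : Prop :=
  (forall u : X, `|u| ^+ 2 = dot u u) /\ finite_dimensional X.

(* The Riesz representative of the differential: it exists in a
   finite-dimensional Hilbert space, and it is unique as [dot] is definite. *)
Definition gradient (R : realType) (X : normedModType R)
    (dot : {dot X for @idfun R}) (h : X -> R) (x : X) : X :=
  xget 0 [set g : X | forall v : X, 'd (h : X -> R^o) x v = dot g v].

Section functions.
Context {R : realType} {X : normedModType R} (dot : {dot X for @idfun R}).
Local Notation "'grad' h" := (gradient dot h) (at level 10, h at level 8).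

Definition smooth (L : R) (h : X -> R) : Prop :=
  (forall x : X, differentiable (h : X -> R^o) x) /\
  (forall x y : X, `|(grad h) x - (grad h) y| <= L * `|x - y|).

Definition weakly_convex (tau : R) (h : X -> R) : Prop :=
  convex_function [set: convex_lmodType X]
    (fun x : X => h x + tau / 2 * `|x| ^+ 2).

Definition inf_value (h : X -> R) : R := inf (range h).

Definition polyak_lojasiewicz (mu : R) (h : X -> R) : Prop :=
  forall x : X, 2 * mu * (h x - inf_value h) <= `|(grad h) x| ^+ 2.

Definition average (n : nat) (f : 'I_n -> X -> R) (x : X) : R :=
  n%:R^-1 * \sum_(i < n) f i x.

(* The pair (x^t, g^t) along one realization [theta], [idx] of the draws. *)
Fixpoint page (n : nat) (f : 'I_n -> X -> R) (gamma : R) (x0 g0 : X)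
    (theta : nat -> bool) (idx : nat -> 'I_n) (t : nat) : X * X :=
  if t is s.+1 then
    let: (x, g) := page f gamma x0 g0 theta idx s in
    let x' := x - gamma *: g in
    (x', if theta s then (grad (average f)) x'
         else g + (grad (f (idx s))) x' - (grad (f (idx s))) x)
  else (x0, g0).

Definition page_stepsize (eta L tau p : R) : R :=
  eta / (L * (1 + Num.sqrt (4 * tau / (L + tau)) * Num.sqrt ((1 - p) / p))).

Definition lyapunov (f : X -> R) (L tau gamma p : R) (xg : X * X) : R :=
  let a := 1 - gamma * (L - tau) / 2 in
  let b := gamma * (L - tau) / 2 in
  let: (x, g) := xg in
  f x - inf_value f - b * gamma * `|(grad f) x| ^+ 2
    + a * gamma / p * `|g - (grad f) x| ^+ 2
    + b * gamma / p * `|g| ^+ 2.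

End functions.

Section probability.
Context {d : measure_display} {T : measurableType d} {R : realType}.
Variable P : probability T R.

Definition mutually_independent (I : choiceType) (F : I -> set (set T)) : Prop :=
  forall (J : {fset I}) (E : I -> set T),
    (forall j, j \in J -> F j (E j)) ->
    P (\bigcap_(j in [set` J]) E j) = (\prod_(j <- J) P (E j))%E.

(* The sigma-algebra generated by [Y], its codomain [S] being discrete. *)
Definition generated_events (S : Type) (Y : T -> S) : set (set T) :=
  [set Y @^-1` A | A in [set: set S]].

Definition discrete_variable (S : Type) (Y : T -> S) : Prop :=
  generated_events Y `<=` measurable.

Record page_draws (n : nat) (p : R) (theta : nat -> T -> bool)
    (idx : nat -> T -> 'I_n) : Prop := PageDraws {
  theta_variable : forall t, discrete_variable (theta t) ;
  idx_variable : forall t, discrete_variable (idx t) ;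
  theta_law : forall t, P (theta t @^-1` [set true]) = p%:E ;
  idx_law : forall t i, P (idx t @^-1` [set i]) = (n%:R^-1)%:E ;
  draws_independent : mutually_independent (fun s : nat + nat =>
    match s with
    | inl t => generated_events (theta t)
    | inr t => generated_events (idx t)
    end)
}.

End probability.

(* Expected number of gradient evaluations of one iteration: [n] with
   probability [p], and 2 with probability [1 - p]. *)
Definition evaluations_per_iteration (R : realType) (n : nat) (p : R) : R :=
  n%:R * p + 2 * (1 - p).

(* Main.v *)
(** A step of PAGE contracts the Lyapunov function in mean.  Write [D_i] for the
    change of the gradient of [f_i] along the step [d = - gamma g] and [D] for
    its mean.  Cocoercivity of the gradient of the convex function
    [f_i + tau/2 |.|^2] reads [|D_i|^2 <= (L - tau) <D_i, d> + L tau |d|^2].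
    The term [(L - tau) <D, d>] of the mean of [|D_i|^2] cancels the cross term
    [2 b <g, D>] of [b |g|^2], and [- b gamma |grad f|^2] absorbs the refreshed
    value of [b |g|^2] when [theta = 1].  With the descent lemma and the choice
    of [gamma], the mean decreases by at least
    [gamma (1 - eta) / 2 (|grad f|^2 + |g - grad f|^2 + |g|^2)], which by the PL
    inequality is at least [rho Psi] for
    [rho = min (gamma (1 - eta) mu) ((1 - eta) p / 2)].  Hence
    [E Psi^t <= (1 - rho)^t Psi^0], and [1 / rho] is [O] of the stated bound. *)

Require Import Defs.
From HB Require Import structures.
From mathcomp Require Import all_boot all_order all_algebra.
From mathcomp Require Import finmap ring lra.
From mathcomp Require Import all_classical all_reals all_analysis.

Set Implicit Arguments.
Unset Strict Implicit.
Unset Printing Implicit Defensive.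

Import Order.TTheory GRing.Theory Num.Theory.
Import numFieldNormedType.Exports.

Local Open Scope classical_set_scope.
Local Open Scope ring_scope.

(** * Gradients in a finite-dimensional Hilbert space *)

Section dot_product.
Context {R : realType} {X : lmodType R} (dot : {dot X for @idfun R}).
Implicit Types u v w : X.

Lemma dotC u v : dot u v = dot v u.
Proof. by rewrite hermC expr0 mul1r. Qed.

Lemma dotDl u v w : dot (u + v) w = dot u w + dot v w.
Proof. exact: linearDl. Qed.

Lemma dotDr u v w : dot w (u + v) = dot w u + dot w v.
Proof. exact: linearDr. Qed.

Lemma dotNl u w : dot (- u) w = - dot u w.
Proof. exact: linearNl. Qed.

Lemma dotNr u w : dot w (- u) = - dot w u.
Proof. exact: linearNr. Qed.

Lemma dotZl a u w : dot (a *: u) w = a * dot u w.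
Proof. exact: linearZl_LR. Qed.

Lemma dotZr a u w : dot w (a *: u) = a * dot w u.
Proof. exact: linearZr_LR. Qed.

Lemma dot0l w : dot 0 w = 0.
Proof. exact: linear0l. Qed.

Lemma dot_suml n (F : 'I_n -> X) w :
  dot (\sum_(i < n) F i) w = \sum_(i < n) dot (F i) w.
Proof. by elim/big_ind2: _ => // [|x a y b <- <-]; rewrite ?dot0l ?dotDl. Qed.

Lemma dot_sumr n (F : 'I_n -> X) w :
  dot w (\sum_(i < n) F i) = \sum_(i < n) dot w (F i).
Proof. by rewrite dotC dot_suml; apply: eq_bigr => i _; rewrite dotC. Qed.

Definition dotE := (dotDl, dotDr, dotNl, dotNr, dotZl, dotZr).

Lemma dot_eq0 u : dot u u = 0 -> u = 0.
Proof.
move=> uu0; apply/eqP; apply: contraT => /(neq0_dnorm_gt0 (s := dot)).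
by rewrite uu0 ltxx.
Qed.

Lemma dot_ge0 u : 0 <= dot u u.
Proof.
by have [->|/(neq0_dnorm_gt0 (s := dot))/ltW//] := eqVneq u 0; rewrite dot0l.
Qed.

Lemma dot_inj u v : (forall w, dot u w = dot v w) -> u = v.
Proof.
move=> uv; apply/eqP; rewrite -subr_eq0; apply/eqP/dot_eq0.
by rewrite dotDl dotNl uv subrr.
Qed.

(* [g] lies in the span of [s]: this is what the second conjunct expresses. *)
Lemma riesz_seq (s : seq X) (l : X -> R^o) : linear l ->
  exists g, (forall v, v \in s -> l v = dot g v) /\
    (forall k : X -> R^o, linear k -> {in s, forall v, k v = 0} -> k g = 0).
Proof.
elim: s l => [|e s IHs] l ll.
  exists 0; split=> // k lk _.
  by have := lk (-1) 0 0; rewrite scaler0 addr0 scaleN1r addNr.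
have dotl u : linear (dot u : X -> R^o) by move=> a x y; rewrite dotDr dotZr.
(* Gram-Schmidt: [g'] is the orthogonal projection of [e] on the span of [s]. If it equals [e], the
   span does not grow and [g] still works. *)
have [g' [eg' sg']] := IHs _ (dotl e).
have [g [eg sg]] := IHs _ ll.
have lB (k1 k2 : X -> R^o) :
    linear k1 -> linear k2 -> linear (fun v => k1 v - k2 v : R^o).
  by move=> l1 l2 a x y; rewrite l1 l2 scalerBr opprD addrACA.
have kD (k : X -> R^o) x y : linear k -> k (x + y) = k x + k y.
  by move=> /(_ 1 x y); rewrite !scale1r.
have [eg'E|ne] := eqVneq e g'.
  exists g; split=> [v|k lk k0].
    rewrite inE => /predU1P[->|/eg//]; rewrite eg'E.
    apply/eqP; rewrite -subr_eq0; apply/eqP.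
    apply: (sg' (fun v => l v - dot g v : R^o)); first exact: lB.
    by move=> v' /eg ->; rewrite subrr.
  by apply: sg => // v vs; rewrite k0// inE vs orbT.
pose u := e - g'.
have us v : v \in s -> dot u v = 0.
  by move=> vs; rewrite dotDl dotNl eg'// subrr.
have ug' : dot u g' = 0 by exact: sg' us.
have uu : 0 < dot u u by apply: neq0_dnorm_gt0; rewrite subr_eq0.
have ue : dot u e = dot u u by rewrite {3}/u dotDr dotNr ug' subr0.
(* As [u] is orthogonal to [s], a correction along [u] keeps the values on [s]; its coefficient
   makes the value at [e] right, by [ue]. *)
exists (g + ((l e - dot g e) / dot u u) *: u); split=> [v|k lk k0].
  rewrite dotDl dotZl inE => /predU1P[->|vs].
    by rewrite ue divfK ?gt_eqF// addrC subrK.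
  by rewrite (us v)// mulr0 addr0 eg.
have k0s v : v \in s -> k v = 0 by move=> vs; rewrite k0// inE vs orbT.
rewrite addrC lk (sg _ lk k0s) addr0.
suff -> : k u = 0 by rewrite scaler0.
by rewrite /u -scaleN1r addrC lk (sg' _ lk k0s) scaler0 add0r k0// inE eqxx.
Qed.

Lemma riesz (l : X -> R^o) : finite_dimensional X -> linear l ->
  exists g, forall v, l v = dot g v.
Proof.
move=> [d [e espan]] ll.
have [g [eg _]] := riesz_seq [seq e i | i <- enum 'I_d] ll.
exists g => v; have [c ->] := espan v.
rewrite dot_sumr.
have l0 : l 0 = 0.
  by have := ll (-1) 0 0; rewrite scaler0 addr0 scaleN1r addNr.
elim/big_rec2 : _ => [|i y x _ <-]; first exact: l0.
by rewrite ll eg ?dotZr// map_f// mem_enum.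
Qed.

End dot_product.

Lemma small_multiple_le0 (R : realFieldType) (c K : R) :
  (forall t, 0 < t <= 1 -> c <= t * K) -> c <= 0.
Proof.
move=> cK; rewrite leNgt; apply/negP => c0.
have K0 : 0 < K.
  by apply: lt_le_trans c0 _; rewrite -[K]mul1r cK// ltr01 lexx.
(* At this [t] the bound reads [c <= c / 2]. The case [t = 1] gives [c <= K], which makes this [t]
   admissible. *)
have c2K : 0 < c / (2 * K) by rewrite divr_gt0// mulr_gt0.
have := cK 1; rewrite ltr01 lexx mul1r => /(_ isT) cK1.
have := cK (c / (2 * K)); rewrite c2K/= ler_pdivrMr ?mulr_gt0// mul1r.
have -> : c / (2 * K) * K = c / 2 by field; rewrite ?gt_eqF.
have -> : c <= 2 * K by lra.
by move=> /(_ isT); lra.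
Qed.

Section gradient.
Context {R : realType} {X : normedModType R} (dot : {dot X for @idfun R}).
Hypothesis hX : finite_dim_hilbert dot.
Local Notation "'grad' h" := (gradient dot h) (at level 10, h at level 8).
Implicit Types (x y v : X) (h : X -> R).

Lemma normE v : `|v| ^+ 2 = dot v v.
Proof. by case: hX => ->. Qed.

Lemma dot_le_norm u v : dot u v <= `|u| * `|v|.
Proof.
have [->|u0] := eqVneq u 0; first by rewrite dot0l mulr_ge0.
have [->|v0] := eqVneq v 0; first by rewrite dotC dot0l mulr_ge0.
have up : 0 < `|u| by rewrite normr_gt0.
have vp : 0 < `|v| by rewrite normr_gt0.
(* Cauchy-Schwarz: this square equals [2 |u| |v| (|u| |v| - dot u v)]. *)
have := dot_ge0 dot (`|v| *: u - `|u| *: v).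
rewrite !dotE -!normE (dotC dot v u) => H.
suff : 0 <= (`|u| * `|v|) * (`|u| * `|v| - dot u v).
  by rewrite pmulr_rge0 ?mulr_gt0// subr_ge0.
nra.
Qed.

Lemma gradientP h x : differentiable (h : X -> R^o) x ->
  forall v, 'd (h : X -> R^o) x v = dot (grad h x) v.
Proof.
move=> dh; rewrite /gradient.
case: xgetP => [g -> //|/= H].
have [_ fdim] := hX.
(* A representative exists, so [xget] cannot have returned its default value 0. *)
have [g gE] := riesz dot fdim (linearP ('d (h : X -> R^o) x)).
by have := H g gE.
Qed.

Lemma gradient_unique h x g : differentiable (h : X -> R^o) x ->
  (forall v, 'd (h : X -> R^o) x v = dot g v) -> grad h x = g.
Proof.
by move=> dh gE; apply: (dot_inj (dot := dot)) => v; rewrite -gE gradientP.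
Qed.

Lemma gradient_average n (f : 'I_n -> X -> R) x :
  (forall i, differentiable (f i : X -> R^o) x) ->
  grad (average f) x = n%:R^-1 *: \sum_(i < n) grad (f i) x.
Proof.
move=> df.
have -> : average f = (n%:R^-1 *: \sum_(i < n) (f i : X -> R^o) : X -> R^o).
  by apply/funext => y; rewrite /average -[RHS]/(_ * _) fct_sumE.
(* Differentiability and the formula for the differential go through the sum together, since the
   second needs the first at each addition. *)
pose isgrad (h : X -> R^o) g :=
  differentiable h x /\ forall v, 'd h x v = dot g v.
have [ds gs] : isgrad (\sum_(i < n) (f i : X -> R^o))
                      (\sum_(i < n) grad (f i) x).
  elim/big_ind2 : _ => [|h g h' g' [dh gh] [dh' gh']|i _].
  - split=> [|v]; first exact: (differentiable_cst (0 : R^o)).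
    by rewrite (diff_cst (0 : R^o) x) dot0l.
  - split=> [|v]; first exact: differentiableD.
    by rewrite diffD//= gh gh' dotDl.
  - by split=> // v; rewrite gradientP.
apply: gradient_unique; first exact: differentiableZ.
by move=> v; rewrite diffZ//= gs dotZl.
Qed.

(** * Inequalities for smooth and weakly convex functions *)

Lemma smooth_dot L h x y v : smooth dot L h ->
  dot (grad h x - grad h y) v <= L * (`|x - y| * `|v|).
Proof.
move=> [_ Lh]; apply: le_trans (dot_le_norm _ _) _.
by rewrite mulrA ler_wpM2r.
Qed.

(** Along the segment from [x] to [y], the function minus its quadratic upper model has a
    nonpositive derivative, by the Lipschitz bound on the gradient. Monotonicity replaces
    integration. *)
Lemma descent L h x y : smooth dot L h ->
  h y <= h x + dot (grad h x) (y - x) + L / 2 * dot (y - x) (y - x).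
Proof.
move=> [dh Lh]; set d := y - x.
pose line := fun t : R => x + t *: d.
(* The difference quotient of [h] along the line is the one defining the directional derivative of
   [h] at [line t]. *)
have lineE t :
    (fun s : R => s^-1 *: ((h \o line) (s *: 1 + t) - (h \o line) t) : R^o)
    = (fun s : R => s^-1 *: (h (s *: d + line t) - h (line t)) : R^o).
  apply/funext => s /=; congr (_ *: (h _ - _)).
  by rewrite /line [s *: 1]mulr1 scalerDl addrCA.
have dline (t : R) : is_derive (t : R^o) (1 : R^o) (h \o line : R^o -> R^o)
    (dot (grad h (line t)) d).
  have dt : derivable (h : X -> R^o) (line t) d by exact: diff_derivable.
  split; first by rewrite /derivable lineE.
  by rewrite /derive lineE -gradientP// -deriveE.
pose psi := fun t : R =>
  h (line t) - t * dot (grad h x) d - L / 2 * dot d d * t ^+ 2.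
have psi' (t : R) : is_derive (t : R^o) (1 : R^o) (psi : R^o -> R^o)
    (dot (grad h (line t)) d - dot (grad h x) d - L * dot d d * t).
  pose q := (h \o line : R^o -> R^o) - (dot (grad h x) d *: (id : R^o -> R^o))
    - ((L / 2 * dot d d) *: (id : R^o -> R^o) ^+ 2).
  have -> : psi = q by apply/funext => s; rewrite /psi /q /= mulrC.
  apply: is_derive_eq.
  rewrite /GRing.scale /=.
  by field.
have : psi 1 <= psi 0.
  apply: (@ler0_derive1_le_cc R psi 0 1); rewrite ?in_itv /= ?lexx ?ler01//.
  - move=> t; rewrite in_itv/= => /andP[t0 t1].
    rewrite derive1E derive_val.
    have := smooth_dot (line t) x d (conj dh Lh).
    have -> : line t - x = t *: d by rewrite /line addrC addKr.
    rewrite normrZ gtr0_norm// -mulrA -expr2 normE.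
    rewrite dotDl dotNl; lra.
  - apply: derivable_within_continuous => t _.
    exact: (@ex_derive _ _ _ _ _ _ _ (psi' t)).
rewrite /psi /line scale1r scale0r addr0 [x + d]addrC subrK.
lra.
Qed.

Lemma weakly_convexP tau h (t : R) x y : weakly_convex tau h -> 0 <= t <= 1 ->
  h (x + t *: (y - x)) <=
    (1 - t) * h x + t * h y + tau / 2 * (t * (1 - t)) * dot (y - x) (y - x).
Proof.
move=> ch /andP[t0 t1].
set z := x + _.
have zE : z = t *: y + (1 - t) *: x.
  by rewrite /z scalerBr scalerBl scale1r addrCA.
have : h z + tau / 2 * `|z| ^+ 2
    <= t * (h y + tau / 2 * `|y| ^+ 2) + (1 - t) * (h x + tau / 2 * `|x| ^+ 2).
  by rewrite zE; apply: (ch (Itv01 t0 t1) y x); rewrite inE.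
rewrite !normE [in dot z z]zE !dotE (dotC dot y x).
move: (h z) (h y) (h x) (dot x x) (dot x y) (dot y y) => *.
lra.
Qed.

(** Compare [h] at [x] and at [z = x + t (y - x)], divide by [t] and let [t] tend to 0. Smoothness
    bounds the error twice: [L / 2] from the descent inequality from [z] to [x], and [L] from
    replacing the gradient at [z] by that at [x]. *)
Lemma weakly_convex_gradient L tau h x y : smooth dot L h ->
  weakly_convex tau h ->
  h x + dot (grad h x) (y - x) - tau / 2 * dot (y - x) (y - x) <= h y.
Proof.
move=> Lh ch.
set a := dot (grad h x) (y - x); set b := dot (y - x) (y - x).
suff key t : 0 < t <= 1 ->
    a - tau / 2 * b - (h y - h x) <= t * ((3 * L - tau) / 2 * b).
  by have := small_multiple_le0 key; lra.
move=> /andP[t0 t1].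
have := @weakly_convexP tau h t x y ch.
rewrite (ltW t0) t1 => /(_ isT).
set z := x + _.
have zx : x - z = (- t) *: (y - x) by rewrite scaleNr /z opprD addrA subrr add0r.
have := descent z x Lh.
have := smooth_dot z x (x - z) Lh.
rewrite (distrC z x) -expr2 normE zx.
rewrite !(dotZl, dotZr) (dotDl dot (gradient dot h z)) dotNl -/a -/b.
move=> H1 H2 H3.
suff : t * (a - tau / 2 * b - (h y - h x))
    <= t * (t * ((3 * L - tau) / 2 * b)) by rewrite ler_pM2l.

lra.
Qed.

(* Minimising over [z] the gap between the upper bound given by smoothness at
   [y] and the lower bound given by weak convexity at [x] yields the choice
   [z = y + w] below. *)
Lemma weakly_convex_smooth_lower L tau h x y :
  0 < L -> 0 <= tau ->
  smooth dot L h -> weakly_convex tau h ->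
  let u := grad h y - grad h x + tau *: (y - x) in
  h x + dot (grad h x) (y - x) + (2 * (L + tau))^-1 * dot u u
    - tau / 2 * dot (y - x) (y - x) <= h y.
Proof.
move=> L0 tau0 Lh ch /=.
have M0 : 0 < L + tau by rewrite ltr_wpDr.
set d := y - x; set u := _ + tau *: d.
pose w := - (L + tau)^-1 *: u.
have := weakly_convex_gradient x (y + w) Lh ch.
have := descent y (y + w) Lh.
have -> : y + w - y = w by rewrite addrC addKr.
have -> : y + w - x = d + w by rewrite addrAC.
have -> : grad h y = grad h x + (u - tau *: d).
  by rewrite addrK addrC subrK.
have uw : dot u w = - (L + tau)^-1 * dot u u by rewrite dotZr.
have ww : dot w w = (L + tau)^-2 * dot u u.
  by rewrite dotZr dotZl mulrA mulrNN -expr2 exprVn.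
clearbody w u d; rewrite !dotE (dotC dot w d) uw ww => up down.
have -> : (2 * (L + tau))^-1 * dot u u
    = (L + tau)^-1 * dot u u - (L + tau) / 2 * ((L + tau)^-2 * dot u u).
  by field; rewrite gt_eqF.
lra.
Qed.

(** Add the lower bounds for [(x, y)] and [(y, x)]: the function values cancel, and multiplying by
    [L + tau] and expanding the square of [D + tau d] gives the claim. *)
Lemma gradient_cocoercive L tau h x y :
  0 < L -> 0 <= tau ->
  smooth dot L h -> weakly_convex tau h ->
  dot (grad h y - grad h x) (grad h y - grad h x) <=
    (L - tau) * dot (grad h y - grad h x) (y - x)
    + L * tau * dot (y - x) (y - x).
Proof.
move=> L0 tau0 Lh ch; set D := grad h y - grad h x.
have M0 : 0 < L + tau by rewrite ltr_wpDr.
have := weakly_convex_smooth_lower x y L0 tau0 Lh ch.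
have := weakly_convex_smooth_lower y x L0 tau0 Lh ch.
rewrite /= -/D -(opprB y x) -(opprB (grad h y)) -/D; set d := y - x.
have -> : grad h y = grad h x + D by rewrite addrC subrK.
clearbody D d; rewrite !dotE (dotC dot d D) => lyx lxy.
have : (L + tau)^-1
      * (dot D D + tau * dot D d + tau * (dot D d + tau * dot d d))
    <= dot D d + tau * dot d d.
  have -> : (L + tau)^-1 = 2 * (2 * (L + tau))^-1 by field; rewrite gt_eqF.
  lra.
rewrite mulrC ler_pdivrMr//; lra.
Qed.
End gradient.

(** * One step of PAGE *)

(* [vv], [gg], [DD] stand for the squared norms of the gradient at [x], of the
   estimate [g] and of the change of gradient; [gv], [gD] are inner products,
   [A] is the mean squared change of the gradients of the components, and [F],
   [F'] are the suboptimality gaps before and after the step. *)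
Lemma lyapunov_contraction (R : realFieldType)
    (L tau gamma p eta mu rho F F' vv gg gv gD DD A : R) :
  let a := 1 - gamma * (L - tau) / 2 in
  let b := gamma * (L - tau) / 2 in
  0 <= tau <= L -> 0 < p <= 1 -> 0 < eta < 1 -> 0 < mu ->
  0 < gamma -> gamma * L <= eta ->
  gamma * tau + 2 * L * tau * gamma ^+ 2 * ((1 - p) / p) <= eta ->
  0 <= rho -> rho <= gamma * (1 - eta) * mu -> rho <= (1 - eta) * p / 2 ->
  0 <= F -> 0 <= DD -> 0 <= vv -> 0 <= gg -> 0 <= gg + vv - 2 * gv ->
  F' <= F - gamma * gv + L / 2 * gamma ^+ 2 * gg ->
  A <= - (gamma * (L - tau) * gD) + L * tau * gamma ^+ 2 * gg ->
  2 * mu * F <= vv ->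
  F' + (1 - p) * (gamma / p)
      * (a * (gg + vv - 2 * gv - DD) + b * gg + 2 * b * gD + A)
    <= (1 - rho) * (F - b * gamma * vv + a * gamma / p * (gg + vv - 2 * gv)
                    + b * gamma / p * gg).
Proof.
move=> a b /andP[tau0 tauL] /andP[p0 p1] /andP[eta0 eta1] mu0 gamma0 gL key.
move=> rho0 rho_mu rho_p F0 DD0 vv0 gg0.
set ee := gg + vv - 2 * gv => ee0 F'le Ale PL.
have aE : a = 1 - b by [].
have b0 : 0 <= b by rewrite /b divr_ge0// mulr_ge0 ?subr_ge0// ltW.
have b_le : b <= eta / 2.
  by rewrite /b ler_pM2r ?invr_gt0//; nra.
set r := (1 - p) / p.
have r0 : 0 <= r by rewrite divr_ge0 ?subr_ge0// ltW.
have qE : p^-1 = 1 + r by rewrite /r; field; rewrite gt_eqF.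
have rE : (1 - p) * (gamma / p) = r * gamma by rewrite /r; ring.
have twob : 2 * b = gamma * (L - tau) by rewrite /b; field.
(* The bound on [A] contains [- 2 b gD], which cancels the cross term; [- a DD] is dropped. *)
have step1 : a * (ee - DD) + b * gg + 2 * b * gD + A
    <= a * ee + b * gg + L * tau * gamma ^+ 2 * gg.
  rewrite twob; nra.
(* After [gv] is polarised by [gvE], the right side minus the left has at least the coefficients
   [gamma (eta / 2 - b)] on [vv] and [ee], and [gamma / 2] times the slack of the stepsize condition
   on [gg]. These are [cvv], [cee] and [cgg]. *)
have progress : F' + r * gamma * (a * (ee - DD) + b * gg + 2 * b * gD + A)
    <= F - b * gamma * vv + a * gamma / p * ee + b * gamma / p * gg
       - gamma * ((1 - eta) / 2) * (vv + ee + gg).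
  have := ler_wpM2l (mulr_ge0 r0 (ltW gamma0)) step1.
  have gvE : gamma * gv = gamma / 2 * (gg + vv - ee) by rewrite /ee; field.
  have cvv : 0 <= (eta / 2 - b) * (gamma * vv).
    by rewrite mulr_ge0 ?subr_ge0// mulr_ge0// ltW.
  have cee : 0 <= (eta / 2 - b) * (gamma * ee).
    by rewrite mulr_ge0 ?subr_ge0// mulr_ge0// ltW.
  have cgg : 0 <= (eta - (gamma * tau + 2 * L * tau * gamma ^+ 2 * r))
                    * (gamma / 2 * gg).
    by rewrite mulr_ge0 ?subr_ge0// mulr_ge0// ltW// divr_gt0.
  have twobg : 2 * b * (gamma * gg) = gamma * (L - tau) * (gamma * gg).
    by rewrite twob.
  rewrite aE -!(mulrA _ gamma) qE gvE in F'le *.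
  clear - F'le cvv cee cgg twobg.
  move: (_ + A) => S; clearbody b ee r; lra.
have q0 : 0 < gamma / p by rewrite divr_gt0.
have rhoF : rho * F <= gamma * ((1 - eta) / 2) * vv.
  apply: le_trans (ler_wpM2r F0 rho_mu) _.
  have -> : gamma * (1 - eta) * mu * F
    = gamma * ((1 - eta) / 2) * (2 * mu * F) by field.
  by rewrite ler_wpM2l// mulr_ge0 ?(ltW gamma0)//; lra.
have rhop : rho * (gamma / p) <= gamma * ((1 - eta) / 2).
  rewrite mulrA ler_pdivrMr// mulrC -mulrA ler_pM2l//; lra.
(* The negative term of the Lyapunov function only helps: scaling it by [1 - rho] increases the
   right-hand side. *)
have rhovv : 0 <= rho * (b * gamma * vv).
  by rewrite mulr_ge0// mulr_ge0// mulr_ge0// ltW.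
have rhoee : rho * (a * gamma / p * ee) <= gamma * ((1 - eta) / 2) * ee.
  rewrite [rho * _]mulrA ler_wpM2r//; apply: le_trans rhop.
  by rewrite ler_wpM2l// -mulrA ler_piMl ?(ltW q0)//; lra.
have rhogg : rho * (b * gamma / p * gg) <= gamma * ((1 - eta) / 2) * gg.
  rewrite [rho * _]mulrA ler_wpM2r//; apply: le_trans rhop.
  by rewrite ler_wpM2l// -mulrA ler_piMl ?(ltW q0)//; lra.
rewrite rE; apply: le_trans progress _; rewrite [(1 - rho) * _]mulrBl mul1r.
clearbody a b ee r.
lra.
Qed.

Section one_step.
Context {R : realType} {X : normedModType R} (dot : {dot X for @idfun R}).
Hypothesis hX : finite_dim_hilbert dot.
Local Notation "'grad' h" := (gradient dot h) (at level 10, h at level 8).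
Context (n : nat) (f_ : 'I_n -> X -> R) (L tau : R).
Hypothesis n0 : (0 < n)%N.
Hypothesis L0 : 0 < L.
Hypothesis tau0 : 0 <= tau.
Hypothesis f_smooth : forall i, smooth dot L (f_ i).
Hypothesis f_convex : forall i, weakly_convex tau (f_ i).
Local Notation f := (average f_).

Lemma mean_const (c : R) : n%:R^-1 * \sum_(i < n) c = c.
Proof.
by rewrite sumr_const card_ord -[c *+ n]mulr_natl mulKf// pnatr_eq0 -lt0n.
Qed.

Lemma grad_averageE x : grad f x = n%:R^-1 *: \sum_(i < n) grad (f_ i) x.
Proof. by apply: (gradient_average hX) => i; have [df _] := f_smooth i. Qed.

Lemma mean_dot_gradient (F : 'I_n -> X) v :
  n%:R^-1 * \sum_(i < n) dot (F i) v = dot (n%:R^-1 *: \sum_(i < n) F i) v.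
Proof. by rewrite dotZl dot_suml. Qed.

(** The descent inequalities of the components are averaged, so smoothness of [f] itself need not be
    derived. *)
Lemma average_descent x d :
  f (x + d) <= f x + dot (grad f x) d + L / 2 * dot d d.
Proof.
rewrite grad_averageE -mean_dot_gradient -[leRHS]addrA.
rewrite -(mean_const (L / 2 * _)) /average -!mulrDr -!big_split /=.
rewrite ler_wpM2l ?invr_ge0//; apply: ler_sum => i _.
rewrite addrA; have := descent hX x (x + d) (f_smooth i).
by have -> : x + d - x = d by rewrite addrC addKr.
Qed.

Lemma mean_sq_gradient_change x d :
  n%:R^-1 * \sum_(i < n) dot (grad (f_ i) (x + d) - grad (f_ i) x)
                             (grad (f_ i) (x + d) - grad (f_ i) x)
    <= (L - tau) * dot (grad f (x + d) - grad f x) d + L * tau * dot d d.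
Proof.
rewrite !grad_averageE -scalerBr -sumrB -mean_dot_gradient.
rewrite -(mean_const (L * tau * _)) mulrCA -mulrDr [(L - tau) * _]mulr_sumr.
rewrite -big_split /= ler_wpM2l ?invr_ge0//; apply: ler_sum => i _.
have := gradient_cocoercive hX x (x + d) L0 tau0 (f_smooth i) (f_convex i).
by have -> : x + d - x = d by rewrite addrC addKr.
Qed.

(** The draw is an explicit argument, so that a run becomes a fold over the list of draws. *)
Definition page_step (gamma : R) (xg : X * X) (z : bool * 'I_n) : X * X :=
  let x' := xg.1 - gamma *: xg.2 in
  (x', if z.1 then grad f x'
       else xg.2 + grad (f_ z.2) x' - grad (f_ z.2) xg.1).

Definition draw_prob (p : R) (z : bool * 'I_n) : R :=
  (if z.1 then p else 1 - p) * n%:R^-1.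

Lemma draw_prob_mean (p : R) (F : bool * 'I_n -> R) :
  \sum_z draw_prob p z * F z =
    p * (n%:R^-1 * \sum_(i < n) F (true, i))
    + (1 - p) * (n%:R^-1 * \sum_(i < n) F (false, i)).
Proof.
rewrite (eq_bigr (fun z => draw_prob p (z.1, z.2) * F (z.1, z.2))); last by case.
rewrite -(pair_bigA _ (fun b i => draw_prob p (b, i) * F (b, i)))/= big_bool/=.
by rewrite /draw_prob/= -!mulr_sumr !mulrA.
Qed.

Lemma lyapunovE (gamma p : R) (x g : X) :
  let a := 1 - gamma * (L - tau) / 2 in
  let b := gamma * (L - tau) / 2 in
  lyapunov dot f L tau gamma p (x, g) =
    f x - inf_value f - b * gamma * dot (grad f x) (grad f x)
    + a * gamma / p * dot (g - grad f x) (g - grad f x)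
    + b * gamma / p * dot g g.
Proof. by rewrite /lyapunov !(normE hX). Qed.

(* The terms quadratic in the change of gradient of a component have total
   weight [(a + b) gamma / p = gamma / p]. *)
Lemma mean_lyapunov_step (gamma p : R) (x g : X) :
  p != 0 ->
  let a := 1 - gamma * (L - tau) / 2 in
  let b := gamma * (L - tau) / 2 in
  let x' := x - gamma *: g in
  let v := grad f x in
  let D := grad f x' - grad f x in
  let A := n%:R^-1 * \sum_(i < n) dot (grad (f_ i) x' - grad (f_ i) x)
                                      (grad (f_ i) x' - grad (f_ i) x) in
  \sum_z draw_prob p z * lyapunov dot f L tau gamma p (page_step gamma (x, g) z)
  = f x' - inf_value f + (1 - p) * (gamma / p)
      * (a * (dot g g + dot v v - 2 * dot g v - dot D D) + b * dot g g
         + 2 * b * dot g D + A).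
Proof.
move=> p0 a b x' v D A; rewrite draw_prob_mean /page_step /=.
rewrite mean_const -/x' -/a -/b.
have DE : grad f x' = v + D by rewrite addrC subrK.
pose Di i := grad (f_ i) x' - grad (f_ i) x.
have meanD : n%:R^-1 *: \sum_(i < n) Di i = D.
  by rewrite /D !grad_averageE -scalerBr sumrB.
have gD i : g + grad (f_ i) x' - grad (f_ i) x = g + Di i.
  exact: (esym (addrA _ _ _)).
under eq_bigr => i _ do rewrite gD !(normE hX).
rewrite !(normE hX).
rewrite subrr dot0l mulr0 addr0.
(* When [theta = 0], the new value is quadratic in [Di i]: [c] is its constant part and
   [dot (Di i) w] its linear part, whose mean is [dot D w]. *)
pose c := f x' - inf_value f - b * gamma * dot (v + D) (v + D)
  + a * gamma / p * dot (g - (v + D)) (g - (v + D)) + b * gamma / p * dot g g.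
pose w := (2 * a * gamma / p) *: (g - (v + D)) + (2 * b * gamma / p) *: g.
have -> : n%:R^-1 * (\sum_(i < n) (f x' - inf_value f
      - b * gamma * dot (grad f x') (grad f x')
      + a * gamma / p * dot (g + Di i - grad f x') (g + Di i - grad f x')
      + b * gamma / p * dot (g + Di i) (g + Di i)))
    = c + dot D w + gamma / p * A.
  rewrite -meanD -mean_dot_gradient /A [gamma / p * _]mulrCA.
  rewrite -(mean_const c) -!mulrDr [gamma / p * _]mulr_sumr -!big_split/= DE.
  congr (_ * _); apply: eq_bigr => i _; rewrite -/(Di i); move: (Di i) => d.
  rewrite /c /w; have -> : a = 1 - b by [].
  clearbody D v b; rewrite !dotE !(dotC dot d).
  rewrite -!(mulrA _ gamma p^-1).
  move: (gamma / p) (f x' - _) => k F.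
  move: (dot v v) (dot D D) (dot g g) (dot d d) (dot g d) (dot v d) (dot D d)
    (dot g v) (dot g D) (dot v g) (dot D g) (dot v D) (dot D v) => *.
  ring.
rewrite DE /c /w; clearbody D v A.
rewrite !dotE !(dotC dot D) (dotC dot v g).
have -> : a = 1 - b by [].
clearbody b; rewrite -!(mulrA _ gamma p^-1).
(* This makes the refreshed term [b gamma / p |grad f x'|^2], weighted by [p], cancel
   [- b gamma |grad f x'|^2]. *)
have gpp : p * (gamma / p) = gamma by rewrite mulrC divfK.
move: (gamma / p) gpp => k <-.
move: (f x' - _) => F.
ring.
Qed.

Lemma lyapunov_step (gamma p eta mu rho : R) (xg : X * X) :
  has_lbound (range f) ->
  0 < mu -> polyak_lojasiewicz dot mu f -> tau <= L ->
  0 < p <= 1 -> 0 < eta < 1 ->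
  0 < gamma -> gamma * L <= eta ->
  gamma * tau + 2 * L * tau * gamma ^+ 2 * ((1 - p) / p) <= eta ->
  0 <= rho -> rho <= gamma * (1 - eta) * mu -> rho <= (1 - eta) * p / 2 ->
  \sum_z draw_prob p z * lyapunov dot f L tau gamma p (page_step gamma xg z)
    <= (1 - rho) * lyapunov dot f L tau gamma p xg.
Proof.
case: xg => x g lbf mu0 PL tauL p01 eta01 gamma0 gL key rho0 rho_mu rho_p.
have p0 : p != 0 by rewrite gt_eqF//; case/andP: p01.
rewrite mean_lyapunov_step// lyapunovE.
have := mean_sq_gradient_change x (- (gamma *: g)).
have := average_descent x (- (gamma *: g)).
have := PL x; rewrite (normE hX).
have : 0 <= f x - inf_value f by rewrite subr_ge0 ge_inf//; exists x.
move: (n%:R^-1 * \sum_(i < n) _) => A.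
move: (grad f x) (grad f (x - gamma *: g)) (f x) (f (x - gamma *: g)).
move=> v v' fx fx'; move: (inf_value _) => m.
have := dot_ge0 dot (v' - v); move: (v' - v) => D.
have := dot_ge0 dot (g - v).
have -> : dot (g - v) (g - v) = dot g g + dot v v - 2 * dot g v.
  by rewrite !dotE (dotC dot v g); ring.
rewrite !(dotNl, dotNr, dotZl, dotZr) (dotC dot v g) (dotC dot D g).
move=> ee0 DD0 gap PLx fle Ale.
apply: (lyapunov_contraction (eta := eta) (mu := mu)) => //.
- by rewrite tau0.
- exact: dot_ge0.
- exact: dot_ge0.
- lra.
- lra.
Qed.

End one_step.

(** * Expectations over the random draws *)

Section draws.
Context {d : measure_display} {T : measurableType d} {R : realType}.
Variable P : probability T R.

(** [F \o Y] is a finite combination of indicators of the fibres of [Y], each integrable. *)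
Lemma expectation_finite (S : finType) (Y : T -> S) (F : S -> R) :
  (forall s, measurable (Y @^-1` [set s])) ->
  ('E_P[F \o Y] = \sum_s (F s)%:E * P (Y @^-1` [set s]))%E.
Proof.
move=> mY; rewrite unlock.
under eq_integral => w _.
  have -> : ((F \o Y) w)%:E
      = (\sum_s (F s)%:E * (\1_(Y @^-1` [set s]) w : R)%:E)%E.
    rewrite (bigD1 (Y w))//= big1 => [|s sY].
      by rewrite adde0 indicE mem_set//= mule1.
    rewrite indicE memNset ?mule0//= => Ys.
    by rewrite Ys eqxx in sY.
  over.
rewrite integral_sum//=; last first.
  by move=> s; apply: integrableZl => //; exact: integrable_indic.
apply: eq_bigr => s _; rewrite integralZl//; last exact: integrable_indic.
by rewrite integral_indic// setIT.
Qed.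

Context (n : nat) (p : R) (theta : nat -> T -> bool) (idx : nat -> T -> 'I_n).
Hypothesis draws : page_draws P p theta idx.

(** The indices of the [2 t] variables that determine the first [t] iterations, in the form that
    [mutually_independent] takes. *)
Fixpoint first_draws t : {fset nat + nat} :=
  if t is s.+1 then (inl s |` (inr s |` first_draws s))%fset else fset0.

Lemma first_drawsP t (s : nat + nat) :
  (s \in first_draws t) = (match s with inl j | inr j => (j < t)%N end).
Proof.
elim: t s => [|t IHt] s; first by case: s.
by rewrite /= !in_fset1U IHt; case: s => j; rewrite ltnS [RHS]leq_eqVlt.
Qed.

Definition draw_event (u : nat -> bool * 'I_n) (s : nat + nat) : set T :=
  match s with
  | inl j => theta j @^-1` [set (u j).1]
  | inr j => idx j @^-1` [set (u j).2]
  end.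

Lemma draw_event_generated u s : (match s with
    | inl t => generated_events (theta t)
    | inr t => generated_events (idx t)
    end) (draw_event u s).
Proof. by case: s => j; [exists [set (u j).1]|exists [set (u j).2]]. Qed.

Lemma measurable_draw_event u s : measurable (draw_event u s).
Proof.
have := draw_event_generated u s.
by case: s => j /=; [apply: (theta_variable draws)|apply: (idx_variable draws)].
Qed.

Lemma theta_prob j b :
  P (theta j @^-1` [set b]) = (if b then p else 1 - p)%:E.
Proof.
case: b; first exact: theta_law draws j.
have -> : theta j @^-1` [set false] = ~` (theta j @^-1` [set true]).
  by apply/seteqP; split=> w /=; case: (theta j w).
rewrite probability_setC; last first.
  (* [idx 0 point] is just some element of ['I_n]; the event reads the first component only. *)
  exact: (measurable_draw_event (fun=> (true, idx 0 point)) (inl j)).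
by rewrite (theta_law draws) EFinB.
Qed.

Definition draws_agree t (u : nat -> bool * 'I_n) : set T :=
  [set w | forall j, (j < t)%N -> (theta j w, idx j w) = u j].

Lemma draws_agreeE t u :
  draws_agree t u = \bigcap_(s in [set` first_draws t]) draw_event u s.
Proof.
apply/seteqP; split=> w.
  move=> H [] j /=; rewrite first_drawsP => /H; case: (u j) => b i [] //=.
move=> H j jt.
have := H (inl j); have := H (inr j); rewrite /= !first_drawsP.
by move=> /(_ jt) -> /(_ jt) ->; rewrite -surjective_pairing.
Qed.

Lemma measurable_draws_agree t u : measurable (draws_agree t u).
Proof.
rewrite draws_agreeE; apply: fin_bigcap_measurable => // s _.
exact: measurable_draw_event.
Qed.

Lemma prob_draws_agree t u :
  P (draws_agree t u) = (\prod_(j < t) draw_prob p (u j))%:E.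
Proof.
rewrite draws_agreeE (draws_independent draws); last first.
  by move=> s _; exact: draw_event_generated.
elim: t => [|t IHt]; first by rewrite big_ord0 big_seq_fset0.
rewrite /= big_fsetU1 ?in_fset1U ?first_drawsP ?ltnn//.
rewrite big_fsetU1 ?first_drawsP ?ltnn// IHt big_ord_recr/= theta_prob.
by rewrite (idx_law draws) -!EFinM mulrA mulrC.
Qed.

Lemma expectation_draws t (F : t.-tuple (bool * 'I_n) -> R) :
  ('E_P[fun w => F [tuple (theta j w, idx j w) | j < t]])%E
  = (\sum_(s : t.-tuple (bool * 'I_n))
       (\prod_(z <- s) draw_prob p z) * F s)%:E.
Proof.
(* Supplies a default for [nth], as ['I_n] is not known to be inhabited here. *)
pose z0 : T -> bool * 'I_n := fun w => (theta 0 w, idx 0 w).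
have pre s : (fun w => [tuple (theta j w, idx j w) | j < t]) @^-1` [set s]
    = draws_agree t (nth (z0 point) s).
  apply/seteqP; split=> w /=.
    move=> <- j jt; rewrite -(tnth_nth _ _ (Ordinal jt)).
    by rewrite tnth_mktuple.
  move=> H; apply: eq_from_tnth => j.
  by rewrite tnth_mktuple (tnth_nth (z0 point)) -H.
rewrite expectation_finite; last first.
  by move=> s; rewrite pre; exact: measurable_draws_agree.
rewrite -sumEFin; apply: eq_bigr => s _.
rewrite pre prob_draws_agree -EFinM mulrC; congr (_ * _)%:E.
by rewrite (big_nth (z0 point)) big_mkord size_tuple.
Qed.

End draws.

(** * Runs of PAGE as iterations over tuples of draws *)

Lemma page_foldl (R : realType) (X : normedModType R)
    (dot : {dot X for @idfun R}) (n : nat) (f_ : 'I_n -> X -> R) (gamma : R)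
    (x0 g0 : X) (theta : nat -> bool) (idx : nat -> 'I_n) (t : nat) :
  page dot f_ gamma x0 g0 theta idx t =
  foldl (page_step dot f_ gamma) (x0, g0) [tuple (theta j, idx j) | j < t].
Proof.
have -> : [tuple (theta j, idx j) | j < t]
    = mkseq (fun j => (theta j, idx j)) t :> seq _.
  by rewrite /= /mkseq -val_enum_ord -map_comp.
elim: t => [//|t IHt]; rewrite mkseqS foldl_rcons -IHt /= /page_step.
by case: page.
Qed.

Lemma sum_tuple_cons (R : nmodType) (S : finType) (t : nat)
    (F : seq S -> R) :
  \sum_(s : t.+1.-tuple S) F s = \sum_z \sum_(s : t.-tuple S) F (z :: s).
Proof.
rewrite pair_bigA (reindex (fun zs : S * t.-tuple S => cons_tuple zs.1 zs.2))//.
exists (fun s => (thead s, behead_tuple s)) => [[z s] _|s _] /=.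
  by congr (_, _); apply: val_inj.
by rewrite [RHS](tuple_eta s); apply: val_inj.
Qed.

(* The left-hand side is the mean of [V] after [t] steps driven by independent
   draws of law [q]. *)
Lemma mean_iterate_le (R : realDomainType) (S : finType) (Z : Type)
    (step : Z -> S -> Z) (V : Z -> R) (q : S -> R) (r : R) :
  0 <= r -> (forall s, 0 <= q s) ->
  (forall z, \sum_s q s * V (step z s) <= r * V z) ->
  forall t z, \sum_(s : t.-tuple S) (\prod_(y <- s) q y) * V (foldl step z s)
    <= r ^+ t * V z.
Proof.
move=> r0 q0 Vstep; elim=> [|t IHt] z.
  rewrite (big_pred1 [tuple]) => [|s]; last exact/esym/eqP/tuple0.
  by rewrite big_nil expr0.
(* Splitting off the first draw [y] lets the induction hypothesis start from [step z y]; the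
   one-step bound then handles [y]. *)
rewrite (sum_tuple_cons t
  (fun s => (\prod_(y <- s) q y) * V (foldl step z s))).
apply: (@le_trans _ _ (\sum_y q y * (r ^+ t * V (step z y)))).
  apply: ler_sum => y _; apply: le_trans (ler_wpM2l (q0 y) (IHt _)).
  by rewrite mulr_sumr; apply: ler_sum => s _; rewrite big_cons mulrA.
under eq_bigr do rewrite mulrCA.
by rewrite -mulr_sumr exprSr -mulrA ler_wpM2l ?exprn_ge0.
Qed.

(** * Number of iterations *)

Lemma ln2_ge_half (R : realType) : 2^-1 <= ln (2 : R).
Proof.
rewrite -[leRHS]opprK -lnV ?posrE// lerNr.
have := @le_ln1Dx R (- 2^-1).
have -> : 1 - 2^-1 = 2^-1 :> R by field.
by apply; lra.
Qed.

Lemma geometric_time (R : realType) (rho Psi0 eps : R) :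
  0 < rho <= 1 -> 0 < eps <= Psi0 / 2 ->
  exists t0 : nat, (forall t, (t0 <= t)%N -> (1 - rho) ^+ t * Psi0 <= eps) /\
    t0%:R <= 3 * rho^-1 * ln (Psi0 / eps).
Proof.
move=> /andP[rho0 rho1] /andP[eps0 epsP].
have Psi00 : 0 < Psi0 by lra.
have ratio2 : 2 <= Psi0 / eps by rewrite ler_pdivlMr//; lra.
have l2 : 2^-1 <= ln (Psi0 / eps).
  apply: le_trans (ln2_ge_half R) _.
  by rewrite ler_ln// posrE// (lt_le_trans _ ratio2).
set l := ln _ in l2 *.
have rhoV : 1 <= rho^-1 by rewrite -invr1 lef_pV2// posrE.
have q0 : 0 <= rho^-1 * l by rewrite mulr_ge0//; lra.
(* Decay follows from [(1 - rho)^t <= exp (- rho t)]. Rounding up costs at most 1, which is at most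
   [2 l / rho] because [l >= 1 / 2] and [rho <= 1]; hence the factor 3. *)
exists (Num.truncn (rho^-1 * l)).+1; split=> [t tt|].
  have lt : l <= rho * t%:R.
    rewrite mulrC -ler_pdivrMr// mulrC.
    apply: le_trans (ltW (truncnS_gt _)) _.
    by rewrite ler_nat.
  have e1 : (1 - rho) ^+ t <= expR (- l).
    apply: (@le_trans _ _ (expR (- rho) ^+ t)).
      by rewrite lerXn2r ?nnegrE ?expR_ge0 ?subr_ge0//; exact: expR_ge1Dx.
    by rewrite -expRM_natl ler_expR mulrN lerN2 mulrC.
  apply: le_trans (ler_wpM2r (ltW Psi00) e1) _.
  rewrite expRN /l lnK ?posrE ?divr_gt0// invf_div divfK// gt_eqF//.
have : (Num.truncn (rho^-1 * l))%:R <= rho^-1 * l by rewrite truncn_le.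
rewrite -natr1 => H.
nra.
Qed.

Lemma page_stepsizeP (R : realType) (eta L tau p : R) :
  0 < eta -> eta < 1 -> 0 < L -> 0 <= tau <= L -> 0 < p <= 1 ->
  let gamma := page_stepsize eta L tau p in
  [/\ 0 < gamma, gamma * L <= eta,
      gamma * tau + 2 * L * tau * gamma ^+ 2 * ((1 - p) / p) <= eta
    & gamma^-1 <= eta^-1 * (L * (1 + 2 * Num.sqrt (tau / (L * p))))].
Proof.
move=> eta0 eta1 L0 /andP[tau0 tauL] /andP[p0 p1] gamma.
pose s : R := Num.sqrt (4 * tau / (L + tau)) * Num.sqrt ((1 - p) / p).
have s0 : 0 <= s by rewrite mulr_ge0 ?sqrtr_ge0.
have s10 : 0 < 1 + s by rewrite ltr_wpDr.
have Ltau0 : 0 < L + tau by rewrite ltr_wpDr.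
have r0 : 0 <= (1 - p) / p by rewrite divr_ge0 ?subr_ge0// ltW.
have sqr_s : s ^+ 2 = 4 * tau / (L + tau) * ((1 - p) / p).
  by rewrite exprMn !sqr_sqrtr// divr_ge0 ?mulr_ge0// ltW.
have gammaE : gamma = eta / (L * (1 + s)) by [].
have gamma0 : 0 < gamma by rewrite divr_gt0// mulr_gt0.
clearbody gamma s.
have yE : gamma * L * (1 + s) = eta by rewrite gammaE; field; rewrite !gt_eqF.
have y0 : 0 <= gamma * L by rewrite mulr_ge0 ?ltW.
(* This splits [eta] for the stepsize condition: the first summand bounds [gamma tau], and the
   second bounds the other term, which is at most its square. *)
have ysE : gamma * L + gamma * L * s = eta by rewrite -yE mulrDr mulr1.
have ys0 : 0 <= gamma * L * s by rewrite mulr_ge0.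
have ys1 : gamma * L * s <= 1 by lra.
split=> //; first by lra.
  have gt_y : gamma * tau <= gamma * L by rewrite ler_wpM2l// ltW.
  have -> : 2 * L * tau * gamma ^+ 2 * ((1 - p) / p)
      = gamma * L * s * (gamma * L * s) * ((L + tau) / (2 * L)).
    have -> : gamma * L * s * (gamma * L * s) = (gamma * L) ^+ 2 * s ^+ 2.
      by ring.
    by rewrite sqr_s; field; rewrite !gt_eqF.
  have half : (L + tau) / (2 * L) <= 1.
    by rewrite ler_pdivrMr ?mul1r ?mulr_gt0//; lra.
  have : gamma * L * s * (gamma * L * s) * ((L + tau) / (2 * L))
      <= gamma * L * s.
    apply: (@le_trans _ _ (gamma * L * s * (gamma * L * s))).
      by rewrite ler_piMr// mulr_ge0.
    by rewrite ler_piMr.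
  lra.
rewrite gammaE invf_div mulrC ler_pM2l ?invr_gt0// ler_pM2l// lerD2l.
have -> : 2 = Num.sqrt (2 ^+ 2) :> R by rewrite sqrtr_sqr ger0_norm.
have q0 : 0 <= tau / (L * p) by rewrite divr_ge0// mulr_ge0// ltW.
rewrite -[leLHS]ger0_norm// -sqrtr_sqr sqr_s -sqrtrM// ler_wsqrtr//.
(* The last factor, at most 1, is what separates [s ^+ 2] from [4 tau / (L p)]. *)
have -> : 4 * tau / (L + tau) * ((1 - p) / p)
    = 2 ^+ 2 * (tau / (L * p)) * (L / (L + tau) * (1 - p)).
  by field; rewrite !gt_eqF.
apply: ler_piMr; first by rewrite mulr_ge0// exprn_ge0.
apply: mulr_ile1; rewrite ?subr_ge0//; [|by rewrite ler_pdivrMr// mul1r lerDl|].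
  by rewrite divr_ge0// ltW.
by lra.
Qed.

(** * Decay in mean and the complexity bounds *)

Lemma expected_lyapunov_le (R : realType) (X : normedModType R)
    (dot : {dot X for @idfun R}) (n : nat) (f_ : 'I_n -> X -> R)
    (L tau mu p eta rho gamma : R) (x0 g0 : X)
    (d : measure_display) (T : measurableType d) (P : probability T R)
    (theta : nat -> T -> bool) (idx : nat -> T -> 'I_n) (t : nat) :
  finite_dim_hilbert dot -> (1 <= n)%N -> 0 < L -> 0 <= tau <= L ->
  (forall i, smooth dot L (f_ i)) -> (forall i, weakly_convex tau (f_ i)) ->
  has_lbound (range (average f_)) ->
  0 < mu -> polyak_lojasiewicz dot mu (average f_) ->
  0 < p <= 1 -> page_draws P p theta idx -> 0 < eta < 1 ->
  0 < gamma -> gamma * L <= eta ->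
  gamma * tau + 2 * L * tau * gamma ^+ 2 * ((1 - p) / p) <= eta ->
  0 <= rho <= 1 -> rho <= gamma * (1 - eta) * mu -> rho <= (1 - eta) * p / 2 ->
  ('E_P[fun w => lyapunov dot (average f_) L tau gamma p
                   (page dot f_ gamma x0 g0 (theta ^~ w) (idx ^~ w) t)]
   <= ((1 - rho) ^+ t
       * lyapunov dot (average f_) L tau gamma p (x0, g0))%:E)%E.
Proof.
move=> hX n0 L0 /andP[tau0 tauL] f_smooth f_convex lbf mu0 PL p01 draws eta01.
move=> gamma0 gL key /andP[rho0 rho1] rho_mu rho_p.
have -> : (fun w => lyapunov dot (average f_) L tau gamma p
                   (page dot f_ gamma x0 g0 (theta ^~ w) (idx ^~ w) t))
  = (fun w => lyapunov dot (average f_) L tau gamma p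
      (foldl (page_step dot f_ gamma) (x0, g0)
         [tuple (theta j w, idx j w) | j < t])).
  by apply/funext => w; rewrite page_foldl.
rewrite (expectation_draws draws (fun s : t.-tuple _ =>
  lyapunov dot (average f_) L tau gamma p
      (foldl (page_step dot f_ gamma) (x0, g0) s))) lee_fin.
apply: (mean_iterate_le (q := draw_prob p)
  (V := lyapunov dot (average f_) L tau gamma p)).
- by rewrite subr_ge0.
- move=> [b i]; rewrite /draw_prob /= mulr_ge0 ?invr_ge0//.
  by case: b; rewrite ?subr_ge0; case/andP: p01 => [/ltW].
- move=> xg; exact: (lyapunov_step hX n0 L0 tau0 f_smooth f_convex xg
    lbf mu0 PL tauL p01 eta01 gamma0 gL key rho0 rho_mu rho_p).
Qed.

Theorem corollary2p1 (R : realType) (eta : R) (eta_gt0 : 0 < eta)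
    (eta_lt1 : eta < 1) :
  exists (C1 C2 : R) (C3 : R -> R),
  [/\ 0 < C1, 0 < C2 & forall c : R, 0 < c -> 0 < C3 c] /\
  forall (X : normedModType R) (dot : {dot X for @idfun R})
    (n : nat) (f_ : 'I_n -> X -> R) (L tau mu p : R) (x0 g0 : X)
    (d : measure_display) (T : measurableType d) (P : probability T R)
    (theta : nat -> T -> bool) (idx : nat -> T -> 'I_n),
  let f := average f_ in
  let kappa := L / mu in
  let gamma := page_stepsize eta L tau p in
  let Psi := fun (t : nat) (w : T) =>
    lyapunov dot f L tau gamma p
      (page dot f_ gamma x0 g0 (theta ^~ w) (idx ^~ w) t) in
  let Psi0 := lyapunov dot f L tau gamma p (x0, g0) in
  finite_dim_hilbert dot ->
  (1 <= n)%N ->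
  0 < L ->
  0 <= tau <= L ->
  (forall i, smooth dot L (f_ i)) ->
  (forall i, weakly_convex tau (f_ i)) ->
  has_lbound (range f) ->
  0 < mu ->
  polyak_lojasiewicz dot mu f ->
  0 < p <= 1 ->
  page_draws P p theta idx ->
  forall eps : R, 0 < eps <= Psi0 / 2 ->
  exists t0 : nat,
  [/\ forall t : nat, (t0 <= t)%N -> ('E_P[Psi t] <= eps%:E)%E,
      t0%:R <= C1 * ((kappa + kappa * Num.sqrt (tau / (L * p)) + 1 / p)
                     * ln (Psi0 / eps)),
      t0%:R * evaluations_per_iteration n p
        <= C2 * ((kappa + kappa * p * n%:R + kappa * Num.sqrt (tau / (L * p))
                  + kappa * Num.sqrt (tau / L) * n%:R * Num.sqrt p
                  + 1 / p + n%:R) * ln (Psi0 / eps))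
    & forall c : R, 0 < c -> c <= n%:R -> p = c / n%:R ->
      t0%:R * evaluations_per_iteration n p
        <= C3 c * ((kappa + kappa * Num.sqrt (tau * n%:R / L) + n%:R)
                   * ln (Psi0 / eps))].
Proof.
have e01 : 0 < eta * (1 - eta) by rewrite mulr_gt0// subr_gt0.
(* [C1] is the 3 of [geometric_time] times the constant of [rhoV]. The 2 in the second constant
   bounds [2 (1 - p)]; in the third, [c + 2] bounds the cost of an iteration, and the other factor
   comes from putting [p = c / n] in [B]. *)
pose C1 := 6 / (eta * (1 - eta)).
have C10 : 0 < C1 by rewrite divr_gt0.
exists C1, (2 * C1), (fun c => C1 * ((c + 2) * (1 + (Num.sqrt c)^-1 + c^-1))).
split.
  split=> [//||c c0]; first by rewrite mulr_gt0.
  by rewrite !mulr_gt0 ?addr_gt0 ?invr_gt0 ?sqrtr_gt0.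
move=> X dot n f_ L tau mu p x0 g0 d T P theta idx f kappa gamma Psi Psi0.
move=> hX n0 L0 tau0L f_smooth f_convex lbf mu0 PL p01 draws eps epsP.
have [gamma0 gL key gammaV] := page_stepsizeP eta_gt0 eta_lt1 L0 tau0L p01.
have [p0 p1] := andP p01; have [tau0 tauL] := andP tau0L.
have kappa0 : 0 < kappa by rewrite divr_gt0.
set q := Num.sqrt (tau / (L * p)).
have q0 : 0 <= q by exact: sqrtr_ge0.
have kq0 : 0 <= kappa * q by exact: mulr_ge0 (ltW kappa0) q0.
have pV0 : 0 < 1 / p by rewrite divr_gt0.
pose rho := Num.min (gamma * (1 - eta) * mu) ((1 - eta) * p / 2).
have rho_mu : rho <= gamma * (1 - eta) * mu by rewrite ge_min lexx.
have rho_p : rho <= (1 - eta) * p / 2 by rewrite ge_min lexx orbT.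
have rho0 : 0 < rho.
  have e1 : 0 < 1 - eta by rewrite subr_gt0.
  rewrite lt_min; apply/andP; split; last by rewrite divr_gt0// mulr_gt0.
  by apply: mulr_gt0 => //; exact: mulr_gt0.
have rho1 : rho <= 1.
  apply: le_trans rho_p _; nra.
have rhoV : rho^-1 <= 2 / (eta * (1 - eta)) * (kappa + kappa * q + 1 / p).
  have k0 : 0 < (eta * (1 - eta))^-1 by rewrite invr_gt0.
  rewrite /rho; case: (leP (gamma * (1 - eta) * mu)) => _.
    have -> : (gamma * (1 - eta) * mu)^-1 = gamma^-1 * ((1 - eta) * mu)^-1.
      by rewrite -invfM mulrA.
    apply: (@le_trans _ _ (eta^-1 * (L * (1 + 2 * q)) * ((1 - eta) * mu)^-1)).
      by rewrite ler_wpM2r// ltW// invr_gt0 mulr_gt0// subr_gt0.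
    have -> : eta^-1 * (L * (1 + 2 * q)) * ((1 - eta) * mu)^-1
        = (eta * (1 - eta))^-1 * (kappa + 2 * (kappa * q)).
      rewrite /kappa; field; rewrite !gt_eqF ?subr_gt0//.
    rewrite [2 / _]mulrC -[leRHS]mulrA ler_pM2l//.
    lra.
  have -> : ((1 - eta) * p / 2)^-1 = 2 / (eta * (1 - eta)) * (eta / p).
    by field; rewrite !gt_eqF ?subr_gt0.
  rewrite ler_pM2l; last by rewrite mulr_gt0.
  apply: (@le_trans _ _ (1 / p)).
    by rewrite ler_pM2r ?invr_gt0// ltW.
  by rewrite lerDr addr_ge0// ltW.
have [t0 [decay t0le]] := geometric_time (introT andP (conj rho0 rho1)) epsP.
set l := ln (Psi0 / eps) in t0le *.
have l0 : 0 <= l.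
  rewrite ln_ge0// ler_pdivlMr; case/andP: epsP; lra.
set B := kappa + kappa * q + 1 / p in rhoV *.
have B0 : 0 <= B.
  by rewrite !addr_ge0// ltW.
have t0B : t0%:R <= C1 * (B * l).
  apply: le_trans t0le _; rewrite mulrA ler_wpM2r//.
  have -> : C1 * B = 3 * (2 / (eta * (1 - eta)) * B).
    by rewrite /C1; field; rewrite !gt_eqF ?subr_gt0.
  by rewrite ler_pM2l.
have ev0 : 0 <= evaluations_per_iteration n p.
  by rewrite addr_ge0 ?mulr_ge0 ?subr_ge0// ltW.
(* Both complexity bounds reduce to comparing [B] times the cost of an iteration with the stated
   sum. *)
have t0ev K : B * evaluations_per_iteration n p <= K ->
    t0%:R * evaluations_per_iteration n p <= C1 * (K * l).
  move=> BK; apply: le_trans (ler_wpM2r ev0 t0B) _.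
  by rewrite -mulrA ler_pM2l// mulrAC ler_wpM2r.
exists t0; split=> [t tt||| c c0 cn pE].
- apply: le_trans (expected_lyapunov_le x0 g0 t hX n0 L0 tau0L f_smooth
    f_convex lbf mu0 PL p01 draws _ gamma0 gL key _ rho_mu rho_p) _.
  + by rewrite eta_gt0.
  + by rewrite (ltW rho0).
  + by rewrite lee_fin; exact: decay.
- exact: t0B.
- set K := _ + n%:R; have -> : 2 * C1 * (K * l) = C1 * (2 * K * l) by ring.
  apply: t0ev; rewrite /K.
  (* This identifies the term in [sqrt p] as the product of [kappa q] and [n p]. *)
  have qp : Num.sqrt (tau / L) * Num.sqrt p = q * p.
    have -> : tau / L = tau / (L * p) * p by field; rewrite !gt_eqF.
    rewrite sqrtrM ?divr_ge0 ?mulr_ge0// ?ltW// -mulrA -expr2 sqr_sqrtr//.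
    exact: ltW.
  have -> : kappa * Num.sqrt (tau / L) * n%:R * Num.sqrt p
      = kappa * n%:R * (q * p) by rewrite -qp; ring.
  apply: (@le_trans _ _ (B * (n%:R * p + 2))).
    by rewrite ler_wpM2l// lerD2l mulrBr; lra.
  have -> : B * (n%:R * p + 2) = kappa * p * n%:R + kappa * n%:R * (q * p)
      + n%:R + 2 * kappa + 2 * (kappa * q) + 2 * (1 / p).
    by rewrite /B; field; rewrite gt_eqF.
  have h3 : 0 <= n%:R :> R by exact: ler0n.
  have h1 := mulr_ge0 (mulr_ge0 (ltW kappa0) (ltW p0)) h3.
  have h2 := mulr_ge0 (mulr_ge0 (ltW kappa0) h3) (mulr_ge0 q0 (ltW p0)).
  lra.
- set m := _ * (1 + _ + _); set K := _ + n%:R.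
  have -> : C1 * m * (K * l) = C1 * (m * K * l) by ring.
  apply: t0ev; rewrite /m /K.
  have cs0 : 0 < Num.sqrt c by rewrite sqrtr_gt0.
  have n0R : 0 < n%:R :> R by rewrite ltr0n.
  have qE : q = (Num.sqrt c)^-1 * Num.sqrt (tau * n%:R / L).
    rewrite /q pE -sqrtrV ?(ltW c0)// -sqrtrM ?invr_ge0 ?(ltW c0)//.
    by congr Num.sqrt; field; rewrite !gt_eqF.
  have evE : evaluations_per_iteration n p <= c + 2.
    have -> : c = n%:R * p by rewrite pE mulrC divfK// gt_eqF.
    by rewrite /evaluations_per_iteration; lra.
  have BE : B = kappa + (Num.sqrt c)^-1 * (kappa * Num.sqrt (tau * n%:R / L))
              + c^-1 * n%:R.
    by rewrite /B qE pE; field; rewrite !gt_eqF.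
  apply: le_trans (ler_wpM2l B0 evE) _.
  rewrite mulrC -mulrA ler_pM2l ?addr_gt0// BE.
  have i0 : 0 < (Num.sqrt c)^-1 by rewrite invr_gt0.
  have j0 : 0 < c^-1 by rewrite invr_gt0.
  have w0 : 0 <= Num.sqrt (tau * n%:R / L) by exact: sqrtr_ge0.
  have kw0 : 0 <= kappa * Num.sqrt (tau * n%:R / L).
    exact: mulr_ge0 (ltW kappa0) w0.
  (* It remains to see that [kappa + i w + j n] is part of the expansion of
     [(1 + i + j) (kappa + w + n)], whose other terms are nonnegative. *)
  move: (Num.sqrt c)^-1 (c^-1) (kappa * Num.sqrt _) i0 j0 kw0 => i j w i0 j0 {}w0.
  have h1 : 0 <= i * kappa by rewrite mulr_ge0// ltW.
  have h2 : 0 <= j * kappa by rewrite mulr_ge0// ltW.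
  have h3 : 0 <= j * w by rewrite mulr_ge0// ltW.
  have h4 : 0 <= i * n%:R by rewrite mulr_ge0// ltW.
  have h5 : 0 <= n%:R :> R by exact: ler0n.
  lra.
Qed.
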